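(* Let $G$ be a right-topological group whose underlying space is a g$\mathcal{N}$-space, and let $X$ be a locally compact regular space. If $\pi\colon G\times X\to X$ is a separately continuous left action of $G$ on $X$, then $\pi$ is jointly continuous (i.e., $G\curvearrowright_\pi X$ is a topological flow).
   Context: No separation axioms are assumed unless stated (regular does not include $T_1$); ''compact'' means every open cover has a finite subcover. A right-topological group is a group $G$ with a topology such that every right translation $x\mapsto xs$ ($s\in G$) is continuous. A left action $G\curvearrowright_\pi X$ is a map $\pi\colon G\times X\to X$, $(t,x)\mapsto tx$, with $ex=x$ and $(st)x=s(tx)$ for all $x\in X$, $s,t\in G$, where $e$ is the unit of $G$. It is separately continuous if $\pi$ is continuous in each variable when the other is fixed, and is a topological flow if $\pi$ is jointly continuous. A space $S$ is a g$\mathcal{N}$-space (generalized Namioka space) if for every compact space $Y$ and every separately continuous $f\colon S\times Y\to\mathbb{R}$ there is at least one point $s\in S$ such that $f$ is jointly continuous at each point of $\{s\}\times Y$. *)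

(* Defs.v *)
From HB Require Import structures.
From mathcomp Require Import all_boot all_order all_algebra.
From mathcomp Require Import all_classical all_reals all_analysis.
Import Order.TTheory GRing.Theory Num.Theory.
Import numFieldNormedType.Exports.

Set Implicit Arguments.
Unset Strict Implicit.
Unset Printing Implicit Defensive.

Local Open Scope classical_set_scope.

HB.mixin Record isRightTopologicalGroup G of monoid.Group G & Topological G := {
  continuous_right_translation : forall s : G, continuous (fun x : G => (x * s)%g)
}.

#[short(type="rightTopologicalGroupType")]
HB.structure Definition RightTopologicalGroup :=
  {G of monoid.Group G & Topological G & isRightTopologicalGroup G}.

Definition separately_continuous (S Y Z : topologicalType) (f : S * Y -> Z) :=
  (forall s, continuous (fun y => f (s, y))) /\
  (forall y, continuous (fun s => f (s, y))).

Definition gNamioka_space (R : realType) (S : topologicalType) :=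
  forall Y : topologicalType, cover_compact [set: Y] ->
  forall f : S * Y -> R, separately_continuous f ->
  exists s : S, forall y : Y, {for (s, y), continuous f}.

(* [locally_compact] also asks the compact neighbourhood to be closed, which is
   not automatic in the absence of the Hausdorff axiom. *)
Definition locally_compact_space (X : topologicalType) :=
  forall x : X, exists2 K : set X, nbhs x K & cover_compact K.

Definition left_action (G : groupType) (X : Type) (pi : G * X -> X) :=
  (forall x, pi (1%g, x) = x) /\
  (forall s t x, pi ((s * t)%g, x) = pi (s, pi (t, x))).

(* Main.v *)
Require Import Defs.
From HB Require Import structures.
From mathcomp Require Import all_boot all_order all_algebra.
From mathcomp Require Import all_classical all_reals all_analysis.

(** For a compact space acted upon, let [t0] and [y0] be given and let [phi] be
    a continuous real function vanishing at [t0 y0] and equal to 1 off a given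
    neighbourhood.  The hypothesis on [G] provides some [s] such that
    [(t, y) |-> phi (t y)] is jointly continuous along the whole slice over
    [s], in particular at [(s, s^-1 t0 y0)].  Because
    [t y = (t t0^-1 s) (s^-1 t0 y)], where [t |-> t t0^-1 s] is a right
    translation and [y |-> s^-1 t0 y] is the action of a fixed element, this
    joint continuity is transported to [(t0, y0)]
    ([compact_action_continuous]).

    A locally compact regular [X] is replaced by its one-point
    compactification, the action being extended so as to fix the point at
    infinity ([opc_action]).  Each element of [G] acts as a homeomorphism of
    [X], hence pulls closed compact sets back to closed compact sets; this is
    exactly continuity at infinity ([continuous_omap]), so the extended action
    is again separately continuous.  Local compactness and regularity of [X]
    make the compactification regular ([opc_regular]).  Compact regular spaces
    are normal, and a regular normal space is completely regular even when its
    points are not closed, whence the function [phi]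
    ([compact_regular_completely_regular]). *)

Import Order.TTheory GRing.Theory Num.Theory.
Import numFieldNormedType.Exports.

Set Implicit Arguments.
Unset Strict Implicit.
Unset Printing Implicit Defensive.

Local Open Scope classical_set_scope.
Local Open Scope ring_scope.

(** * Compact regular spaces *)

Lemma cover_compact_compact (T : topologicalType) (A : set T) :
  cover_compact A -> compact A.
Proof.
move=> Aco F PF FA; have [a _] := filter_ex FA.
(* Properness of [F] gives a point [a], which makes [T] a pointed space. *)
pose pT : ptopologicalType := HB.pack T (isPointed.Build T a).
by have /(_ F PF FA) : @compact pT A by rewrite compact_cover.
Qed.

(** The usual passage from a finite subcover to the union of its members, once
    for two properties: having a closure inside a given set, and being closed
    and compact.  Stability under unions makes the supersets of members of [P]
    a filter base, so the near-covering form of compactness selects a single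
    member without handling a finite cover. *)
Lemma compact_nbhs_ind (T : topologicalType) (A : set T) (P : set (set T)) :
  compact A -> P set0 -> setU_closed P ->
  (forall x, A x -> exists2 V, nbhs x V & P V) ->
  exists2 V, P V & A `<=` V°.
Proof.
move=> /compact_near_coveringP Aco P0 PU PA.
pose F := filter_from P (fun V => [set W | V `<=` W]).
have FF : Filter F.
  apply: filter_from_filter; first by exists set0.
  move=> U V PU' PV; exists (U `|` V); first exact: PU.
  by move=> W /=; rewrite subUset.
have [|V PV /(_ V)] := Aco _ F (fun V x => V° x) FF; last first.
  by move=> AV; exists V => //; exact: AV.
move=> x /PA[V xV PV]; exists (V°, [set W | V `<=` W]).
  by split; [exact: nbhs_interior|exists V].
by case=> y W [/= Vy VW]; exact: interiorS Vy.
Qed.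

Lemma compact_regular_normal (T : topologicalType) :
  compact [set: T] -> regular_space T -> normal_space T.
Proof.
move=> Tco Treg A clA B AB.
have Aco : compact A by apply: subclosed_compact Tco _.
have [|||V cVB AV] := @compact_nbhs_ind T A [set V | closure V `<=` B] Aco.
- by rewrite /= closure0.
- by move=> U V UB VB; rewrite /= closureU subUset.
- by move=> x /AB /Treg[V xV VB]; exists V.
- by exists V => // x /AV.
Qed.

(** Points need not be closed, so Urysohn's lemma is applied to [closure [set x]]
    instead: by regularity it lies in every neighbourhood of [x]. *)
Lemma regular_normal_completely_regular (R : realType) (T : topologicalType) :
  regular_space T -> normal_space T -> completely_regular_space T.
Proof.
move=> Treg /(@normal_separatorP R) Tsep x B clB nBx.
have : uniform_separator (closure [set x]) B.
  apply: Tsep => //; first exact: closed_closure.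
  apply/disjoints_subset.
  have [V xV VB] : filter_from (nbhs x) closure (~` B).
    by apply: Treg; apply: open_nbhs_nbhs; split => //; exact: closed_openC.
  apply: subset_trans VB; apply: closureS => _ ->; exact: nbhs_singleton.
move=> /(@uniform_separatorP _ R)[f [fc f01 f0 f1]].
apply/(@uniform_separatorP _ R); exists f; split => //.
by apply: subset_trans f0; apply: image_subset; exact: subset_closure.
Qed.

Lemma compact_regular_completely_regular (R : realType) (T : topologicalType) :
  compact [set: T] -> regular_space T -> completely_regular_space T.
Proof.
move=> Tco Treg; apply: (@regular_normal_completely_regular R) => //.
exact: compact_regular_normal.
Qed.

(** * Actions on compact regular spaces *)

Lemma compact_action_continuous (R : realType) (G : rightTopologicalGroupType)
    (Y : topologicalType) (rho : G * Y -> Y) :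
  gNamioka_space R G -> cover_compact [set: Y] ->
  regular_space Y -> left_action rho -> separately_continuous rho ->
  continuous rho.
Proof.
move=> GN Yco Yreg [_ rhoM] [rhoY rhoG] [t0 y0] U Unbhs.
have [phi [phic _ phi0 phi1]] : exists phi : Y -> R,
    [/\ continuous phi, range phi `<=` `[0, 1],
        phi @` [set rho (t0, y0)] `<=` [set 0] & phi @` (~` U°) `<=` [set 1]].
  apply/uniform_separatorP; apply: (@compact_regular_completely_regular R) => //.
    exact: cover_compact_compact.
  exact/open_closedC/open_interior.
have [|s fs] := GN Y Yco (phi \o rho).
  split=> [t|y] z.
    by apply: (@continuous_comp _ _ _ (fun y => rho (t, y)) phi);
      [exact: rhoY|exact: phic].
  by apply: (@continuous_comp _ _ _ (fun t => rho (t, y)) phi);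
    [exact: rhoG|exact: phic].
(* [h] leaves [rho] unchanged and moves [(t0, y0)] into the slice over [s]. *)
pose h (p : G * Y) : G * Y :=
  ((p.1 * (t0^-1 * s))%g, rho ((s^-1 * t0)%g, p.2)).
have rhoh p : rho (h p) = rho p.
  case: p => t y; rewrite /h /= -rhoM; congr (rho (_, _)).
  by rewrite !mulgA mulgK mulgVK.
have ht0 : h (t0, y0) = (s, rho ((s^-1 * t0)%g, y0)).
  by rewrite /h /= mulgA mulgV mul1g.
have hc : {for (t0, y0), continuous h}.
  have h1 : {for (t0, y0), continuous (fun p : G * Y => (p.1 * (t0^-1 * s))%g)}.
    apply: (@continuous_comp _ _ _ fst (fun t : G => (t * (t0^-1 * s))%g)).
      exact: cvg_fst.
    exact: continuous_right_translation.
  have h2 : {for (t0, y0), continuous (fun p => rho ((s^-1 * t0)%g, p.2))}.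
    apply: (@continuous_comp _ _ _ snd (fun y => rho ((s^-1 * t0)%g, y))).
      exact: cvg_snd.
    exact: rhoY.
  exact: cvg_pair h1 h2.
have fc : {for (t0, y0), continuous (phi \o rho)}.
  have -> : phi \o rho = (phi \o rho) \o h.
    by apply/funext => p /=; rewrite rhoh.
  by apply: continuous_comp => //; rewrite ht0; exact: fs.
have fz : phi (rho (t0, y0)) = 0 by apply: phi0; exists (rho (t0, y0)).
have : \forall p \near (t0, y0), phi (rho p) < 1.
  have near0 : \forall r \near phi (rho (t0, y0)), r < 1.
    by rewrite fz; apply: open_nbhs_nbhs; split; [exact: open_lt|exact: ltr01].
  exact: fc near0.
apply: filterS => p p1; apply: (@interior_subset _ U); apply: contrapT => nU.
have E : phi (rho p) = 1 by apply: phi1; exists (rho p).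
by move: p1; rewrite E ltxx.
Qed.

(** * One-point compactification of an action *)

Local Notation opc := one_point_compactification.

Lemma locally_compact_regular_nbhs (X : topologicalType) (x : X) (U : set X) :
  locally_compact_space X -> regular_space X -> nbhs x U ->
  exists2 K, nbhs x K & [/\ compact K, closed K & K `<=` U].
Proof.
move=> Xlc Xreg xU; have [C xC /cover_compact_compact Cco] := Xlc x.
have [V xV VUC] := Xreg x (U `&` C) (filterI xU xC).
exists (closure V); first by apply: filterS xV; exact: subset_closure.
split; [|exact: closed_closure|by move=> y /VUC[]].
by apply: subclosed_compact Cco _; [exact: closed_closure|move=> y /VUC[]].
Qed.

(** Off the image, points of [X] are handled by closedness of [K], and infinity
    by its compactness. *)
Lemma opc_closed_some (X : topologicalType) (K : set X) :
  compact K -> closed K -> closed (Some @` K : set (opc X)).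
Proof.
move=> Kco Kcl; rewrite -[Some @` K]setCK; apply: open_closedC.
rewrite openE => -[x|] /= nK.
  have : nbhs x (~` K).
    apply: open_nbhs_nbhs; split; first exact: closed_openC.
    by move=> Kx; apply: nK; exists x.
  by apply: filterS => y nKy [z Kz [zy]]; apply: nKy; rewrite -zy.
exists K => // _ [[y nKy <-] [z Kz [zy]]|-> [//]].
by apply: nKy; rewrite -zy.
Qed.

Lemma opc_regular (X : topologicalType) :
  locally_compact_space X -> regular_space X -> regular_space (opc X).
Proof.
move=> Xlc Xreg [x|] U.
  move=> /(locally_compact_regular_nbhs Xlc Xreg)[K xK [Kco Kcl KU]].
  exists (Some @` K); first exact: one_point_compactification_some_nbhs.
  have /closure_id <- := opc_closed_some Kco Kcl.
  by move=> _ [y /KU + <-].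
(* A neighbourhood of infinity is the complement of a closed compact [C]; a
   closed neighbourhood inside it comes from a closed compact neighbourhood
   [D] of [C]. *)
move=> [C [Cco Ccl] CU].
have [|||D [Dco Dcl] CD] := @compact_nbhs_ind X C (compact `&` closed) Cco.
- by split; [exact: compact0|exact: closed0].
- by move=> A B [? ?] [? ?]; split; [exact: compactU|exact: closedU].
- move=> x _; have [K xK [Kco Kcl _]] :=
    locally_compact_regular_nbhs Xlc Xreg (filterT : nbhs x setT).
  by exists K.
exists (Some @` (~` D) `|` [set None]); first by exists D.
move=> [x|] clx; last by apply: CU; right.
apply: CU; left; exists x => // /CD Dx.
have [_ [[[y nDy <-]|->] [z Dz]]] :=
  clx _ (one_point_compactification_some_nbhs x D Dx); last by [].
by case=> zy; apply: nDy; rewrite -zy.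
Qed.

(** Continuity at infinity: the preimage under [f] of a compact set is its
    image under the inverse [g]. *)
Lemma continuous_omap (X : topologicalType) (f g : X -> X) :
  cancel f g -> cancel g f -> continuous f -> continuous g ->
  continuous (omap f : opc X -> opc X).
Proof.
move=> fK gK fc gc [x|] U; first exact: fc.
move=> [C [Cco Ccl] CU]; exists (f @^-1` C).
  split; last by apply: preimage_closed => // x _; exact: fc.
  have -> : f @^-1` C = g @` C.
    apply/seteqP; split=> [x Cfx|_ [y Cy <-]]; last by rewrite /= gK.
    by exists (f x).
  by apply: continuous_compact => //; exact: continuous_subspaceT.
by move=> _ [[x nCx <-]|->]; apply: CU; [left; exists (f x)|right].
Qed.

Definition opc_action (G X : Type) (pi : G * X -> X) (p : G * opc X) : opc X :=
  omap (fun x => pi (p.1, x)) p.2.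

Lemma opc_action_left_action (G : groupType) (X : Type) (pi : G * X -> X) :
  left_action pi -> left_action (opc_action pi).
Proof.
move=> [pi1 piM]; split=> [[x|]//|s t [x|]//]; rewrite /opc_action /=.
  by rewrite pi1.
by rewrite piM.
Qed.

Lemma opc_action_separately_continuous (G : rightTopologicalGroupType)
    (X : topologicalType) (pi : G * X -> X) :
  left_action pi -> separately_continuous pi ->
  separately_continuous (opc_action pi).
Proof.
move=> [pi1 piM] [piX piG]; split=> [t|[x|]].
- apply: (@continuous_omap X (fun x => pi (t, x)) (fun x => pi (t^-1%g, x))).
  + by move=> x; rewrite -piM mulVg.
  + by move=> x; rewrite -piM mulgV.
  + exact: piX.
  + exact: piX.
- by move=> t U; exact: piG.
- exact: cst_continuous.
Qed.

Theorem theorem1p2 (R : realType) (G : rightTopologicalGroupType)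
    (X : topologicalType) (pi : G * X -> X)
    (G_gN : gNamioka_space R G)
    (X_lc : locally_compact_space X) (X_reg : regular_space X)
    (pi_act : left_action pi) (pi_sep : separately_continuous pi) :
  continuous pi.
Proof.
have Yco := @one_point_compactification_compact X.
have rhoc : continuous (opc_action pi).
  apply: (compact_action_continuous G_gN) => //.
  - by rewrite -compact_cover.
  - exact: opc_regular.
  - exact: opc_action_left_action.
  - exact: opc_action_separately_continuous.
move=> [t x] U piU.
have := rhoc (t, Some x) _ (one_point_compactification_some_nbhs _ U piU).
move=> [[V W] /= [tV xW] VWU]; exists (V, Some @^-1` W) => //.
by move=> [s y] [/= Vs Wy]; have [z Uz [<-]] := VWU (s, Some y) (conj Vs Wy).
Qed.
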